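(* Let $m\ge1$ be an integer, $a_m$ a real constant, $\Delta t,\Delta x>0$, and $\nu_m=\Delta t\,a_m/\Delta x^m$. The $m+1$ first-order time-marching finite-difference schemes $$u(x,\Delta t)=\sum_{k=-r}^{m-r}c_k\,u(x+k\Delta x,0),$$ characterized by $r=0,1,2,\dots,m$, for solving the equation $$\frac{\partial u}{\partial t}=a_m\partial_x^m u$$ have the explicit solutions $$c_0=1+(-1)^m(-1)^r C_r^m\,\nu_m\qquad\text{and}\qquad c_k=(-1)^m(-1)^{r+k}C_{r+k}^m\,\nu_m\quad (k\neq0,\ -r\le k\le m-r),$$ where $C_k^m=\dfrac{m!}{k!\,(m-k)!}$ are binomial coefficients.
   Context: A scheme of the form $u(x,\Delta t)=\sum_{k=-r}^{m-r}c_k\,u(x+k\Delta x,0)$ with $m+1$ grid points $k=-r,\dots,m-r$ is a first-order time-marching scheme for $\partial_t u=a_m\partial_x^m u$ if the formal power series $e^{\Delta t\,a_m\partial_x^m}$ and $\sum_{k=-r}^{m-r}c_k e^{k\Delta x\,\partial_x}$ in $\partial_x$ agree through the power $\partial_x^m$; i.e. $\sum_k c_k=1$, $\sum_k c_k k^{\ell}=0$ for $1\le\ell\le m-1$, and $\sum_k c_k k^m=m!\,\nu_m$. The number $\nu_m$ is called the generalized Courant number. *)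

(* Defs.v *)
From HB Require Import structures.
From mathcomp Require Import all_boot all_order all_algebra.
From mathcomp Require Import reals.

Set Implicit Arguments.
Unset Strict Implicit.
Unset Printing Implicit Defensive.

Import Order.TTheory GRing.Theory Num.Theory.
Local Open Scope ring_scope.

(* A formal power series in D = d/dx is represented by its sequence of
   coefficients, nat -> R. *)

(* exp(p) = sum_j p^j / j! for p in D R[D].  Since p has no constant term,
   p^j has no term of degree < j, so the coefficient of D^n only involves
   j <= n.  The definition is meaningful only when p`_0 = 0. *)
Definition fps_exp (R : realType) (p : {poly R}) (n : nat) : R :=
  \sum_(j < n.+1) (p ^+ j)`_n / (j`!)%:R.

(* Formal solution operator exp(dt a D^m) of u_t = a (d/dx)^m u. *)
Definition evolution_symbol (R : realType) (m : nat) (a dt : R) : nat -> R :=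
  fps_exp ((dt * a) *: 'X^m).

(* Symbol sum_(-r <= k <= m-r) c_k exp(k dx D) of the scheme
   u(x, dt) = sum_(-r <= k <= m-r) c_k u(x + k dx, 0), using
   u(x + k dx) = exp(k dx D) u (x).  The m+1 grid points are k = i - r for
   0 <= i <= m; the values of c off the stencil are irrelevant. *)
Definition scheme_symbol (R : realType) (m r : nat) (dx : R) (c : int -> R)
    (n : nat) : R :=
  \sum_(i < m.+1)
    c (i%:Z - r%:Z) * fps_exp (((i%:Z - r%:Z)%:~R * dx) *: 'X) n.

Definition first_order_scheme (R : realType) (m r : nat) (a dt dx : R)
    (c : int -> R) : Prop :=
  forall n : nat, (n <= m)%N ->
    evolution_symbol m a dt n = scheme_symbol m r dx c n.

Definition courant (R : realType) (m : nat) (a dt dx : R) : R :=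
  dt * a / dx ^+ m.

(* Main.v *)
Require Import Defs.
From HB Require Import structures.
From mathcomp Require Import all_boot all_order all_algebra.
From mathcomp Require Import reals.
From mathcomp Require Import ring zify.

(** Agreement through order [m] prescribes [\sum_k c_k p(k)] for the monomials
    [p] of degree at most [m]: the functional is [phi p = p(0) + m! nu p_m],
    with [p_m] the coefficient of degree [m].  As Lagrange interpolation at the
    [m+1] grid points is exact in these degrees, this holds if and only if each
    [c_k] is the value of [phi] at the Lagrange polynomial of the grid point
    [k].  The constant term of that polynomial is [1] if [k = 0] and [0]
    otherwise, since [0] is itself a grid point, and its leading coefficient is
    the inverse of [\prod_(j != i) (i - j) = (-1)^(m-i) i! (m-i)!] for
    [i = r + k]. *)

Set Implicit Arguments.
Unset Strict Implicit.
Unset Printing Implicit Defensive.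

Import Order.TTheory GRing.Theory Num.Theory.
Local Open Scope ring_scope.

(** Both directions rest on linearity. From right to left, ['X^k] is expanded in the Lagrange basis.
    From left to right, exactness on monomials extends to all polynomials of size at most [n] and is
    then tested on the Lagrange polynomials, which are 0 or 1 at the nodes. *)
Lemma moments_lagrange (K : fieldType) (n : nat) (x : nat -> K)
    (phi : {scalar {poly K}}) (w : 'I_n -> K) :
  (0 < n)%N -> injective x ->
  (forall k, (k < n)%N -> \sum_(i < n) w i * x i ^+ k = phi 'X^k) <->
  (forall i, w i = phi (tnth (lagrange n x) i)).
Proof.
move=> n_gt0 x_inj; split=> [moments i | w_lagrange k lt_kn]; last first.
  rewrite (lagrange_gen n_gt0 x_inj (p := 'X^k)) ?size_polyXn // linear_sum.
  apply: eq_bigr => i _ /=.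
  by rewrite mul_polyC linearZ /= -w_lagrange hornerXn mulrC.
have exact_poly (p : {poly K}) : (size p <= n)%N -> phi p = \sum_(j < n) w j * p.[x j].
  move=> size_p; rewrite -{1}[p]coefK poly_def linear_sum /=.
  under [RHS]eq_bigr => j _ do rewrite horner_coef mulr_sumr.
  rewrite exchange_big; apply: eq_bigr => k _ /=.
  rewrite linearZ /= -moments ?(leq_trans (ltn_ord k)) // mulr_sumr.
  by apply: eq_bigr => j _; rewrite mulrCA.
rewrite exact_poly ?size_lagrange_ // (bigD1 i) //= lagrange_sample // eqxx.
rewrite mulr1 big1 ?addr0 // => j /negPf ji.
by rewrite lagrange_sample // eq_sym ji mulr0.
Qed.

(** Induction on [m - i] with [i] fixed: the nodes below [i] contribute [i!], and passing from
    [m = i + d] to [i + d + 1] adds the factor [-(d + 1)]. *)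
Lemma prod_nat_node_diff (K : comNzRingType) (m i : nat) : (i <= m)%N ->
  \prod_(0 <= j < m.+1 | j != i) (i%:R - j%:R : K) =
  (-1) ^+ (m - i) * (i`! * (m - i)`!)%:R.
Proof.
move=> /subnKC {1}<-; elim: (m - i)%N => [|d IHd].
  rewrite addn0 big_mkcond big_nat_recr //= eqxx mulr1 -big_mkcond /= fact0.
  rewrite muln1 mul1r big_mkord (reindex_inj rev_ord_inj) /=.
  rewrite (eq_bigl xpredT) => [|j]; last by apply/eqP; have := ltn_ord j; lia.
  rewrite fact_prod big_add1 big_mkord natr_prod; apply: eq_bigr => j _.
  by rewrite -natrB ?leq_subr // subKn.
rewrite addnS big_mkcond big_nat_recr //= -big_mkcond IHd ifT; last by lia.
by rewrite factS !natrM exprS -[(i + d).+1]addnS natrD; ring.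
Qed.

Lemma coef_lagrange (K : fieldType) (m : nat) (x : nat -> K) (i : 'I_m.+1) :
  injective x ->
  (tnth (lagrange m.+1 x) i)`_m = (\prod_(j < m.+1 | j != i) (x i - x j))^-1.
Proof.
move=> x_inj; set L := tnth _ _.
(* [L] has degree exactly [m]: it is a monic product of [m] linear factors divided by its value at
   [x i]. *)
have -> : L`_m = lead_coef L by rewrite /lead_coef size_lagrange_.
rewrite /L lagrangeE //= lead_coefM lead_coefC horner_prod.
rewrite (monicP (monic_prod_XsubC _ _ _)) mulr1; congr _^-1.
by apply: eq_bigr => j _; rewrite hornerXsubC.
Qed.

Definition order_functional (K : comNzRingType) (m : nat) (nu : K)
    (p : {poly K}) : K := p.[0] + m`!%:R * nu * p`_m.

Fact order_functional_is_scalar (K : comNzRingType) (m : nat) (nu : K) :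
  scalar (order_functional m nu).
Proof.
by move=> b p q; rewrite /order_functional hornerD hornerZ coefD coefZ; ring.
Qed.

HB.instance Definition _ (K : comNzRingType) (m : nat) (nu : K) :=
  GRing.isLinear.Build K {poly K} K *%R (order_functional m nu)
    (order_functional_is_scalar m nu).

Lemma natr_sub_inj (K : numDomainType) (b : K) :
  injective (fun j : nat => j%:R - b).
Proof. by move=> j k /addIr /eqP; rewrite eqr_nat => /eqP. Qed.

Lemma order_functional_lagrange (K : numFieldType) (m r : nat) (nu : K)
    (i : 'I_m.+1) : (r <= m)%N ->
  order_functional m nu (tnth (lagrange m.+1 (fun j => j%:R - r%:R)) i) =
  (i == r :> nat)%:R + (-1) ^+ m * (-1) ^+ i * 'C(m, i)%:R * nu.
Proof.
move=> le_rm; set x := fun j : nat => j%:R - r%:R : K.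
have x_inj : injective x := @natr_sub_inj _ _.
have le_im : (i <= m)%N by rewrite -ltnS.
(* The node of index [r] is 0, so evaluation at 0 is sampling at a node. *)
have lagrange0 (L : {poly K}) : L.[0] = L.[x (Ordinal (le_rm : r < m.+1)%N)].
  by rewrite /x /= subrr.
rewrite /order_functional lagrange0 lagrange_sample // coef_lagrange //.
rewrite -val_eqE /=; congr (_ + _).
(* The shift by [r] cancels in differences of nodes. *)
under eq_bigr => j _ do rewrite opprB addrA subrK.
have -> : \prod_(j < m.+1 | j != i) (i%:R - j%:R) =
    (-1) ^+ (m - i) * (i`! * (m - i)`!)%:R :> K.
  by rewrite -prod_nat_node_diff // big_mkord.
(* Writing [m!] as ['C(m, i) * (i! * (m - i)!)] cancels the denominator; the sign splits because
   [m - i] and [m + i] have the same parity. *)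
rewrite -(bin_fact le_im) natrM invfM invr_sign.
have fact_neq0 : (i`! * (m - i)`!)%:R != 0 :> K.
  by rewrite pnatr_eq0 -lt0n muln_gt0 !fact_gt0.
rewrite -signr_odd oddB // signr_addb !signr_odd.
by move: (_`! * _)%:R fact_neq0 => f f_neq0; field.
Qed.

(** The [j]th power lives in degree [m * j], so through degree [m] only [j = 0] and [j = 1]
    contribute. *)
Lemma evolution_symbolE (R : realType) (m n : nat) (a dt : R) :
  (0 < m)%N -> (n <= m)%N ->
  evolution_symbol m a dt n = (n == 0)%:R + (n == m)%:R * (dt * a).
Proof.
move=> m_gt0 le_nm; rewrite /evolution_symbol /fps_exp.
under eq_bigr => j _ do rewrite exprZn -exprM coefZ coefXn.
(* The truncated sum has [n.+1] terms, so the term [j = 1] occurs only for positive [n]. *)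
case: n le_nm => [|n] le_nm.
  rewrite big_ord1 muln0 /= fact0 divr1 expr0 mul1r.
  by rewrite [0%N == m]ltn_eqF ?mulr1n // mul0r addr0.
rewrite add0r 2!big_ord_recl big1 ?addr0 => [|j _]; last first.
  by rewrite /= ltn_eqF ?mulr0 ?mul0r //; move: (nat_of_ord j); rewrite /bump; nia.
by rewrite /= muln0 mulr0 mul0r add0r /bump muln1 divr1 expr1 mulrC.
Qed.

(** Each exponent is a multiple of ['X], so only its [n]th power reaches degree [n]; what remains is
    a rescaled [n]th moment of the weights. *)
Lemma scheme_symbolE (R : realType) (m r n : nat) (dx : R) (c : int -> R) :
  scheme_symbol m r dx c n =
  dx ^+ n / n`!%:R * \sum_(i < m.+1) c (i%:Z - r%:Z) * (i%:R - r%:R) ^+ n.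
Proof.
rewrite mulr_sumr; apply: eq_bigr => i _.
rewrite /fps_exp (bigD1 ord_max) //= big1 ?addr0 => [|j j_max].
  by rewrite exprZn coefZ coefXn eqxx mulr1 exprMn rmorphB /= !pmulrn; ring.
rewrite exprZn coefZ coefXn [n == j]eq_sym.
by rewrite -[X in _ == X]/(val (@ord_max n)) val_eqE (negPf j_max) mulr0 mul0r.
Qed.

Lemma first_order_schemeE (R : realType) (m r : nat) (a dt dx : R)
    (c : int -> R) : (0 < m)%N -> (r <= m)%N -> dx != 0 ->
  first_order_scheme m r a dt dx c <->
  forall i : 'I_m.+1, c (i%:Z - r%:Z) = (i == r :> nat)%:R
    + (-1) ^+ m * (-1) ^+ i * 'C(m, i)%:R * courant m a dt dx.
Proof.
move=> m_gt0 le_rm dx_neq0; set nu := courant m a dt dx.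
pose x (j : nat) : R := j%:R - r%:R.
have x_inj : injective x := @natr_sub_inj _ _.
(* Cancelling the nonzero factor [dx ^+ n / n!] turns agreement in degree [n] into a moment
   condition; at [n = m] this factor converts [dt * a] into [m! * nu]. *)
have momentE n : (n <= m)%N ->
    evolution_symbol m a dt n = scheme_symbol m r dx c n <->
    \sum_(i < m.+1) c (i%:Z - r%:Z) * x i ^+ n = order_functional m nu 'X^n.
  move=> le_nm; rewrite evolution_symbolE // scheme_symbolE.
  have scale_neq0 : dx ^+ n / n`!%:R != 0.
    by rewrite mulf_neq0 ?expf_neq0 ?invr_eq0 ?pnatr_eq0 -?lt0n ?fact_gt0.
  have -> : (n == 0)%:R + (n == m)%:R * (dt * a) =
      dx ^+ n / n`!%:R * order_functional m nu 'X^n.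
    rewrite /order_functional hornerXn expr0n coefXn [m == n]eq_sym /nu /courant.
    case: eqP => [->|_] /=; first
      by rewrite fact0 [0%N == m]ltn_eqF //= expr0 divr1 mul1r mulr0 mul0r.
    case: eqP => [->|_] /=; last by ring.
    by field; rewrite expf_neq0 // pnatr_eq0 -lt0n fact_gt0.
  by split=> [/(mulfI scale_neq0)|] ->.
have [moments_w w_moments] := moments_lagrange (order_functional m nu)
  (fun i : 'I_m.+1 => c (i%:Z - r%:Z)) isT x_inj.
split=> [order_c i | c_def n le_nm].
  rewrite -order_functional_lagrange // -moments_w // => n le_nm.
  exact/momentE/order_c.
apply/momentE/w_moments => // i.
by rewrite c_def -order_functional_lagrange.
Qed.

Theorem theorem4 (R : realType) (m r : nat) (a dt dx : R) (c : int -> R)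
    (hm : (1 <= m)%N) (hr : (r <= m)%N) (hdt : 0 < dt) (hdx : 0 < dx) :
  first_order_scheme m r a dt dx c <->
  c 0 = 1 + (-1) ^+ m * (-1) ^+ r * 'C(m, r)%:R * courant m a dt dx /\
  (forall k : int, k != 0 -> - r%:Z <= k <= m%:Z - r%:Z ->
     c k = (-1) ^+ m * (-1) ^ (r%:Z + k) * 'C(m, `|(r%:Z + k)%R|%N)%:R
           * courant m a dt dx).
Proof.
rewrite first_order_schemeE ?gt_eqF //; split=> [c_def | [c0 ck] i].
  split=> [|k k_neq0 /andP[k_ge k_le]].
    by have := c_def (Ordinal (hr : (r < m.+1)%N)); rewrite /= subrr eqxx.
  (* On the stencil [r + k] is nonnegative: the integer exponent and the absolute value both reduce
     to the natural index [n] of the grid point. *)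
  have [n defn] : exists n : nat, r%:Z + k = n%:Z by exists `|(r%:Z + k)%R|%N; lia.
  have lt_nm : (n < m.+1)%N by lia.
  have := c_def (Ordinal lt_nm); rewrite /= defn.
  have -> : n%:Z - r%:Z = k by lia.
  by have -> : (n == r) = false; [lia | rewrite add0r].
have [-> | ir_neq] := eqVneq (i : nat) r; first by rewrite subrr c0.
rewrite ck ?add0r; first by rewrite addrC subrK.
  by rewrite subr_eq0.
by have := ltn_ord i; lia.
Qed.
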